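(* Consider the pricing model described in the context with $C\ge1$ servers, and any $\Lambda>0$, $\mu>0$ and regular $F$. Let $\pi^*$ be an optimal dynamic policy and $\tilde\lambda=\sum_{i\ge0}\lambda_i^*\mathbb{P}_i(\pi^* )$ its average arrival rate. For integers $\gamma\ge0$ and $C\ge1$ define \[ g(\gamma,C)=\sup_{\lambda\in(0,C]}\frac{\sum_{i=1}^{\gamma+1} i\,q_i^{\gamma,C}(\lambda)}{\lambda}, \] where $q_i^{\gamma,C}(\lambda)$, $i=0,\dots,\gamma+1$, are the stationary probabilities of the birth–death process on $\{0,\dots,\gamma+1\}$ with birth rate $\lambda$ in states $0,\dots,\gamma$ and death rate $\min(i,C)$ in state $i$ (i.e. $q_i^{\gamma,C}(\lambda)\propto\prod_{k=1}^{i}\frac{\lambda}{\min(k,C)}$). Then for every $\gamma\in\{C-1,C,C+1,\dots\}$ the static policy $\pi^{\tilde\lambda,\gamma}$ simultaneously satisfies \[ \mathcal{R}(\pi^{\tilde\lambda,\gamma})\ \ge\ \left(1-\frac{\frac{C^C}{C!}}{\sum_{l=0}^{C}\frac{1}{l!}C^l+\frac{1}{C!}C^C(\gamma+1-C)}\right)\mathcal{R}(\pi^* )\qquad\text{and}\qquad \mathcal{C}(\pi^{\tilde\lambda,\gamma})\ \le\ g(\gamma,C)\,\mathcal{C}(\pi^* ). \]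
   Context: Model: a service system with $C\ge 1$ identical parallel servers and one first-come-first-served queue of unlimited size. Potential customers arrive according to a Poisson process of rate $\Lambda>0$; each has a valuation drawn i.i.d. from a regular (in Myerson's sense) distribution $F$. A customer offered price $p$ joins iff their valuation is at least $p$, so the effective arrival rate is $\lambda(p)=\Lambda(1-F(p))$; this map is assumed to be a bijection between prices and rates, with inverse $p(\lambda)$, and $\lambda\mapsto\lambda p(\lambda)$ is concave. Service times are i.i.d. exponential with rate $\mu>0$, independent of valuations. The provider incurs a congestion cost $c>0$ per customer in the system per unit time. A policy $\pi$ is a sequence $(\lambda_0,\lambda_1,\dots)$ with $\lambda_i\in[0,\Lambda]$: with $i$ customers present the price $p(\lambda_i)$ is posted. The number in system is a birth–death process with birth rate $\lambda_i$ and death rate $\mu\min(i,C)$ in state $i$; when stable its stationary probabilities are $\mathbb{P}_i(\pi)=\prod_{k=0}^{i-1}\frac{\lambda_k}{\mu\min(k+1,C)}\big/\big(1+\sum_{n\ge0}\prod_{k=0}^{n}\frac{\lambda_k}{\mu\min(k+1,C)}\big)$. Revenue rate $\mathcal{R}(\pi)=\sum_{i}\lambda_i p(\lambda_i)\mathbb{P}_i(\pi)$; congestion cost $\mathcal{C}(\pi)=c\sum_i i\,\mathbb{P}_i(\pi)$ ($+\infty$ if unstable); objective $\mathcal{Z}(\pi)=\mathcal{R}(\pi)-\mathcal{C}(\pi)$. An optimal dynamic policy $\pi^*=(\lambda_0^*,\lambda_1^*,\dots)$ maximizes $\mathcal{Z}$ over all such policies. For a rate $\lambda$ and integer $\gamma\ge0$,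 the static (cutoff) policy $\pi^{\lambda,\gamma}$ uses arrival rate $\lambda$ in states $0,1,\dots,\gamma$ and arrival rate $0$ in all states $\ge\gamma+1$. *)

(* Defs.v *)
From HB Require Import structures.
From mathcomp Require Import all_boot all_order all_algebra.
From mathcomp Require Import all_classical all_reals all_analysis.

Set Implicit Arguments.
Unset Strict Implicit.
Unset Printing Implicit Defensive.

Import Order.TTheory GRing.Theory Num.Theory.
Import numFieldNormedType.Exports.

Local Open Scope classical_set_scope.
Local Open Scope ring_scope.

Section valuations.
Context (R : realType).

Definition cdf_of (F : probability (measurableTypeR R) R) (v : R) : R :=
  fine (F `]-oo, v]%classic).

Definition is_density (F : probability (measurableTypeR R) R) (f : R -> R) :=
  [/\ measurable_fun [set: R] f,
      forall v, 0 <= f v &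
      forall A : set (measurableTypeR R), measurable A ->
        F A = (\int[lebesgue_measure]_(v in A) (f v)%:E)%E].

(* The interior of the support of the valuations is {v | 0 < F v < 1}, an
   interval on which the density has to be positive; the virtual value
   v - (1 - F v) / f v is required to be nondecreasing, not necessarily
   strictly. *)
Definition myerson_regular (F : probability (measurableTypeR R) R) :=
  exists f : R -> R,
    [/\ is_density F f,
        forall v, 0 < cdf_of F v < 1 -> 0 < f v &
        {in [set v | 0 < cdf_of F v < 1] &,
           {homo (fun v => v - (1 - cdf_of F v) / f v) : v w / v <= w}}].

Definition effective_rate (Lambda : R)
    (F : probability (measurableTypeR R) R) (v : R) : R :=
  Lambda * (1 - cdf_of F v).

(* [price] inverts the bijection between prices and rates. Rate 0 is left out:
   when the valuations are unbounded no real price induces it, and the value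
   chosen for [price 0] is immaterial because prices enter the model only
   through the product l * price l, which vanishes at l = 0. When a real price
   does induce rate 0, [prices] is the set of the remaining ones. *)
Definition inverse_demand (Lambda : R)
    (F : probability (measurableTypeR R) R) (prices : set R)
    (price : R -> R) :=
  set_bij prices `]0, Lambda] (effective_rate Lambda F) /\
  forall l, 0 < l <= Lambda ->
    prices (price l) /\ effective_rate Lambda F (price l) = l.

Definition concave_revenue (Lambda : R) (price : R -> R) :=
  convex_function (`[0, Lambda] : set R^o) (fun l => - (l * price l)).

End valuations.

Section queue.
Context (R : realType).

(* Unnormalised stationary weight of state i: birth rate [birth k] in state k,
   death rate [death k] in state k (with k > 0). *)
Definition bd_weight (birth death : nat -> R) (i : nat) : R :=
  \prod_(k < i) (birth k / death k.+1).

Definition service_rate (C : nat) (mu : R) (i : nat) : R :=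
  mu * (minn i C)%:R.

Definition is_policy (Lambda : R) (pi : nat -> R) :=
  forall i, 0 <= pi i <= Lambda.

Definition static_policy (l : R) (gamma : nat) (i : nat) : R :=
  if (i <= gamma)%N then l else 0.

Definition normalizer (C : nat) (mu : R) (pi : nat -> R) : \bar R :=
  (\sum_(0 <= i <oo) (bd_weight pi (service_rate C mu) i)%:E)%E.

Definition stable (C : nat) (mu : R) (pi : nat -> R) : Prop :=
  (normalizer C mu pi < +oo)%E.

(* Identically 0 when the policy is unstable, since then [fine] sends the
   infinite normalizer to 0. *)
Definition stat_prob (C : nat) (mu : R) (pi : nat -> R) (i : nat) : R :=
  bd_weight pi (service_rate C mu) i / fine (normalizer C mu pi).

Definition revenue (C : nat) (mu : R) (price : R -> R) (pi : nat -> R) : R :=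
  limn (series (fun i => pi i * price (pi i) * stat_prob C mu pi i)).

Definition cost (C : nat) (mu c : R) (pi : nat -> R) : \bar R :=
  if `[< stable C mu pi >] then
    (c%:E * \sum_(0 <= i <oo) (i%:R * stat_prob C mu pi i)%:E)%E
  else +oo%E.

Definition objective (C : nat) (mu c : R) (price : R -> R) (pi : nat -> R) :
    \bar R :=
  ((revenue C mu price pi)%:E - cost C mu c pi)%E.

Definition optimal_policy (C : nat) (Lambda mu c : R) (price : R -> R)
    (pi : nat -> R) :=
  is_policy Lambda pi /\
  forall pi', is_policy Lambda pi' ->
    (objective C mu c price pi' <= objective C mu c price pi)%E.

Definition avg_rate (C : nat) (mu : R) (pi : nat -> R) : R :=
  limn (series (fun i => pi i * stat_prob C mu pi i)).

Definition cutoff_prob (gamma C : nat) (l : R) (i : nat) : R :=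
  let w := bd_weight (fun=> l) (service_rate C 1) in
  w i / \sum_(j < gamma.+2) w j.

Definition g (gamma C : nat) : \bar R :=
  ereal_sup [set ((\sum_(1 <= i < gamma.+2) i%:R * cutoff_prob gamma C l i)
                    / l)%:E
            | l in [set l : R | 0 < l <= C%:R]].

End queue.

Arguments g {R} gamma C.

(* Main.v *)
(* Comparison with the policy that admits nobody shows that pi is stable and has
   nonnegative revenue. Let l be its average arrival rate. Global balance
   l_i P_i = mu min(i+1, C) P_(i+1) gives l <= mu C, and, min(i, C) being at most i,
   Little's law in the form l / mu <= sum_i i P_i, so that the cost ratio is at
   most g at the load l / mu. By Jensen's inequality the revenue of pi is at
   most l p(l), while the static policy earns l p(l) times the probability of
   not being blocked; blocking increases with the load, and at load C its
   probability is the explicit fraction. *)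
Require Import Defs.
From mathcomp Require Import all_boot all_order all_algebra.
From mathcomp Require Import all_classical all_reals all_analysis.
From mathcomp Require Import ring lra.
Import Order.TTheory GRing.Theory Num.Theory.
Import numFieldNormedType.Exports.
Local Open Scope classical_set_scope.
Local Open Scope ring_scope.

(** * Real series: partial sums, finite support, passage to extended reals *)

Lemma le_series_lim (R : realType) (u : nat -> R) n :
  (forall i, 0 <= u i) -> cvgn (series u) -> series u n <= limn (series u).
Proof.
move=> u0 cu; apply: nondecreasing_cvgn_le => // a b ab.
by have := @nondecreasing_series R u xpredT 0%N (fun i _ _ => u0 i); apply.
Qed.

Lemma cvg_series_finite (R : realType) (u : nat -> R) N :
  (forall i, (N <= i)%N -> u i = 0) -> series u @ \oo --> \sum_(0 <= i < N) u i.
Proof.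
move=> u0; apply: cvg_near_cst; near=> n.
have Nn : (N <= n)%N by near: n; exact: nbhs_infty_ge.
rewrite /series/= (big_cat_nat (n:=N))//= [X in _ + X](_ : _ = 0) ?addr0//.
by rewrite big_nat big1// => i /andP[Ni _]; exact: u0.
Unshelve. all: by end_near.
Qed.

Lemma eseries_EFin (R : realType) (u : nat -> R) : cvgn (series u) ->
  (\sum_(0 <= i <oo) (u i)%:E)%E = (limn (series u))%:E.
Proof.
move=> cu; rewrite -EFin_lim//; congr (limn _); apply/funext => n.
by rewrite /series/= sumEFin.
Qed.

(** * Jensen's inequality for a countable distribution on [0, L] *)

Section concave.
Variables (R : realType) (L : R) (f : R -> R).
Hypothesis L_gt0 : 0 < L.
Hypothesis f_concave : forall t x y,
  0 <= t <= 1 -> 0 <= x <= L -> 0 <= y <= L ->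
  t * f x + (1 - t) * f y <= f (t * x + (1 - t) * y).
Hypothesis f0 : f 0 = 0.

(** From below, f lies above its chord from (0, 0) to (L, f L). From above, the midpoint inequality
    f x + f (L - x) <= 2 f (L / 2) is combined with the lower bound at L - x. *)
Lemma concave_bounded : exists2 M, 0 <= M & forall x, 0 <= x <= L -> `|f x| <= M.
Proof.
have lower x : 0 <= x <= L -> - `|f L| <= f x.
  move=> /andP[x0 xL].
  have t01 : 0 <= x / L <= 1 by rewrite ler_pdivrMr// mul1r xL divr_ge0// ltW.
  have LL : 0 <= L <= L by rewrite lexx ltW.
  have L0 : 0 <= (0 : R) <= L by rewrite lexx ltW.
  have := f_concave _ _ _ t01 LL L0.
  rewrite f0 !mulr0 !addr0 divfK ?gt_eqF//; apply: le_trans.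
  case/andP: t01 => t0 t1; rewrite lerNl -mulrN (le_trans (ler_norm _))//.
  by rewrite normrM normrN ger0_norm// ler_piMl.
exists (2 * `|f (L / 2)| + `|f L|) => [|x xL]; first by rewrite addr_ge0// mulr_ge0.
have x'L : 0 <= L - x <= L by lra.
have h01 : 0 <= (2^-1 : R) <= 1 by lra.
have := f_concave _ _ _ h01 xL x'L.
have -> : 2^-1 * x + (1 - 2^-1) * (L - x) = L / 2 by field.
have := lower _ xL; have := lower _ x'L.
have := ler_norm (f (L / 2)); have := normr_ge0 (f (L / 2)).
by rewrite ler_norml => *; lra.
Qed.

(** The missing mass sits at an arbitrary point y, which makes the induction work: the last atom
    [x n] is merged with y into their weighted mean, and the induction hypothesis is applied at that
    mean. *)
Lemma concave_jensen_fin n (p x : nat -> R) y :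
  (forall i, 0 <= p i) -> (forall i, 0 <= x i <= L) -> 0 <= y <= L ->
  \sum_(0 <= i < n) p i <= 1 ->
  \sum_(0 <= i < n) f (x i) * p i + (1 - \sum_(0 <= i < n) p i) * f y
    <= f (\sum_(0 <= i < n) x i * p i + (1 - \sum_(0 <= i < n) p i) * y).
Proof.
move=> p0 xL; elim: n y => [|n IH] y yL; first by rewrite !big_geq// subr0 !add0r !mul1r.
rewrite !big_nat_recr//=.
have : 0 <= p n by [].
set A := \sum_(0 <= i < n) p i; set S := \sum_(0 <= i < n) _; set T := \sum_(0 <= i < n) _ * _.
move=> pn A1; have A1' : A <= 1 by lra.
(* If the first n weights already exhaust the mass, then [p n] vanishes and the merging ratio p n /
   (1 - A) would be 0 / 0. *)
have [A'1|/eqP A'1] := eqVneq (1 - A) 0.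
  have pn0 : p n = 0 by lra.
  have -> : 1 - (A + p n) = 0 by lra.
  rewrite pn0 !mulr0 !mul0r !addr0.
  by have := IH y yL A1'; rewrite -/A A'1 !mul0r !addr0.
have A'0 : 0 < 1 - A by rewrite lt_def; apply/andP; split; [exact/eqP|lra].
have [t t01 tA] : exists2 t, 0 <= t <= 1 & t * (1 - A) = p n.
  exists (p n / (1 - A)); last by rewrite divfK ?gt_eqF.
  by rewrite ler_pdivrMr// mul1r divr_ge0 ?(ltW A'0)//=; lra.
have zL : 0 <= t * x n + (1 - t) * y <= L.
  have := xL n; move: t01 yL => /andP[t0 t1] /andP[y0 yL] /andP[x0 xnL].
  have t'0 : 0 <= 1 - t by lra.
  have p1 : 0 <= t * (L - x n) by rewrite mulr_ge0 ?subr_ge0.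
  have p2 : 0 <= (1 - t) * (L - y) by rewrite mulr_ge0 ?subr_ge0.
  by rewrite addr_ge0 ?mulr_ge0//=; lra.
have := IH _ zL A1'.
have := ler_wpM2l (ltW A'0) (f_concave _ _ _ t01 (xL n) yL).
have -> : T + (1 - A) * (t * x n + (1 - t) * y) = T + x n * p n + (1 - (A + p n)) * y.
  by rewrite -tA; ring.
have -> : (1 - A) * (t * f (x n) + (1 - t) * f y) = f (x n) * p n + (1 - (A + p n)) * f y.
  by rewrite -tA; ring.
by rewrite -/A -/S -/T => *; lra.
Qed.

Variables p x : nat -> R.
Hypotheses (p_ge0 : forall i, 0 <= p i) (x_bnd : forall i, 0 <= x i <= L).
Hypothesis p_cvg : series p @ \oo --> (1 : R).

Lemma is_cvg_series_bounded_mul (h : nat -> R) M :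
  (forall i, `|h i| <= M) -> cvgn (series (fun i => h i * p i)).
Proof.
move=> hM; apply: normed_cvg.
apply: (@series_le_cvg _ _ (M *: p)) => [n|n|n|].
- exact: normr_ge0.
- by rewrite mulr_ge0// (le_trans _ (hM n)).
- by rewrite /= normrM (ger0_norm (p_ge0 n)) ler_wpM2r.
- by apply: is_cvg_seriesZ; apply/cvg_ex; exists 1.
Qed.

Lemma is_cvg_series_mean : cvgn (series (fun i => x i * p i)).
Proof.
apply: (@is_cvg_series_bounded_mul _ L) => i.
by case/andP: (x_bnd i) => x0 ?; rewrite ger0_norm.
Qed.

(* The mass outside the first n states is put at its own mean y. Since f is
   bounded, its contribution vanishes in the limit, so that no continuity of f
   at the endpoints of [0, L] is needed. *)
Lemma concave_jensen :
  limn (series (fun i => f (x i) * p i)) <= f (limn (series (fun i => x i * p i))).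
Proof.
have [M M0 fM] := concave_bounded.
have cp : cvgn (series p) by apply/cvg_ex; exists 1.
have limp : limn (series p) = 1 by apply/cvg_lim.
have cf : cvgn (series (fun i => f (x i) * p i)).
  by apply: (@is_cvg_series_bounded_mul _ M) => i; exact: fM.
have cx := is_cvg_series_mean.
set m := limn (series (fun i => x i * p i)).
(* An upper bound for the n-th partial sum: the missing mass contributes at least - M per unit. *)
pose r n := f m + (1 - series p n) * M.
have rm : r @ \oo --> f m.
  rewrite -[X in _ --> X]addr0 -[in X in _ --> X](mul0r M) -(subrr 1).
  by apply: cvgD; [exact: cvg_cst|apply: cvgM; [apply: cvgB => //; exact: cvg_cst|exact: cvg_cst]].
rewrite -(cvg_lim (@Rhausdorff R) rm); apply: ler_lim => //.
  by apply/cvg_ex; exists (f m).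
near=> n; rewrite /r.
have A1 : series p n <= 1 by rewrite -limp; exact: le_series_lim.
have Sm : series (fun i => x i * p i) n <= m.
  by apply: le_series_lim => // i; case/andP: (x_bnd i) => x0 _; rewrite mulr_ge0.
(* The terms (L - x i) * p i are nonnegative, so their partial sums stay below the limit L - m. This
   is what keeps the mean of the remaining mass at most L. *)
have gap : L * series p n - series (fun i => x i * p i) n <= L - m.
  have cLp : cvgn (series (L *: p)) by exact: is_cvg_seriesZ.
  have LB0 i : 0 <= (L *: p - (fun i => x i * p i)) i.
    rewrite -[leRHS]/(L * p i - x i * p i) -mulrBl mulr_ge0// subr_ge0.
    by case/andP: (x_bnd i).
  have := le_series_lim _ _ n LB0 (is_cvg_seriesB cLp cx).
  by rewrite lim_seriesB// lim_seriesZ// limp seriesD seriesN seriesZ -[(L *: 1)%R]/(L * 1) mulr1.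
have [y yL ym] : exists2 y, 0 <= y <= L &
    m = series (fun i => x i * p i) n + (1 - series p n) * y.
  have [A0|An0] := eqVneq (1 - series p n) 0.
    (* No mass remains, so any y would do: [gap] and [Sm] force the partial sum to equal m. *)
    exists 0; first by rewrite lexx ltW.
    rewrite A0 mul0r addr0; apply/eqP; rewrite eq_le Sm andbT.
    have : series p n = 1 by lra.
    by move: gap => /[swap] ->; lra.
  have A'0 : 0 < 1 - series p n by rewrite lt_def An0; lra.
  exists ((m - series (fun i => x i * p i) n) / (1 - series p n)); last by field.
  by rewrite ler_pdivrMr// divr_ge0 ?subr_ge0 ?(ltW A'0)//=; lra.
have := concave_jensen_fin n _ _ _ p_ge0 x_bnd yL A1; rewrite -ym.
have := fM _ yL; rewrite ler_norml => /andP[fy _].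
have : (1 - series p n) * - M <= (1 - series p n) * f y by rewrite ler_wpM2l//; lra.
by rewrite /series/=; lra.
Unshelve. all: by end_near.
Qed.

End concave.

(** * Stationary law of a stable policy and bounds on its average arrival rate *)

Section birth_death.
Variable R : realType.
Implicit Types birth death : nat -> R.

Lemma bd_weight0 birth death : bd_weight birth death 0 = 1.
Proof. by rewrite /bd_weight big_ord0. Qed.

Lemma bd_weightS birth death i :
  bd_weight birth death i.+1 = bd_weight birth death i * (birth i / death i.+1).
Proof. by rewrite /bd_weight big_ord_recr. Qed.

Lemma bd_weight_ge0 birth death i : (forall k, 0 <= birth k) ->
  (forall k, 0 <= death k.+1) -> 0 <= bd_weight birth death i.
Proof. by move=> b0 d0; apply: prodr_ge0 => k _; rewrite divr_ge0. Qed.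

Lemma service_rate_gt0 C (mu : R) i : (0 < C)%N -> 0 < mu ->
  0 < service_rate C mu i.+1.
Proof. by move=> C0 mu0; rewrite mulr_gt0// ltr0n leq_min C0. Qed.

Variables (C : nat) (mu Lambda : R) (pi : nat -> R).
Hypotheses (C_gt0 : (0 < C)%N) (mu_gt0 : 0 < mu) (pi_ge0 : forall i, 0 <= pi i).
Hypothesis pi_stable : stable C mu pi.

Let w := bd_weight pi (service_rate C mu).
Let P := stat_prob C mu pi.

Lemma policy_weight_ge0 i : 0 <= w i.
Proof. by apply: bd_weight_ge0 => // k; rewrite ltW// service_rate_gt0. Qed.

Lemma is_cvg_policy_weight : cvgn (series w).
Proof. exact: nnseries_is_cvg policy_weight_ge0 pi_stable. Qed.

Lemma normalizerE : normalizer C mu pi = (limn (series w))%:E.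
Proof. by rewrite /normalizer eseries_EFin//; exact: is_cvg_policy_weight. Qed.

Lemma normalizer_gt0 : 0 < limn (series w).
Proof.
apply: lt_le_trans (le_series_lim _ _ 1 policy_weight_ge0 is_cvg_policy_weight).
by rewrite /series/= big_nat1 /w bd_weight0.
Qed.

Lemma stat_probE i : P i = w i / limn (series w).
Proof. by rewrite /P /stat_prob normalizerE. Qed.

Lemma stat_prob_ge0 i : 0 <= P i.
Proof. by rewrite stat_probE divr_ge0 ?policy_weight_ge0// ltW// normalizer_gt0. Qed.

Lemma cvg_stat_prob : series P @ \oo --> (1 : R).
Proof.
have -> : series P = fun n => series w n * (limn (series w))^-1.
  by apply/funext => n; rewrite /series/= mulr_suml; apply: eq_bigr => i _; rewrite stat_probE.
rewrite -[X in _ --> X](@divff _ (limn (series w))) ?gt_eqF ?normalizer_gt0//.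
by apply: cvgM; [exact: is_cvg_policy_weight|exact: cvg_cst].
Qed.

(** The flow across the cut between i and i + 1. Summed over i, it gives both bounds on the average
    rate, through the two bounds on min(i + 1, C). *)
Lemma stat_prob_balance i : pi i * P i = service_rate C mu i.+1 * P i.+1.
Proof.
have s0 := service_rate_gt0 C mu i C_gt0 mu_gt0.
rewrite !stat_probE /w bd_weightS.
by field; rewrite !gt_eqF ?normalizer_gt0.
Qed.

Hypothesis pi_le : forall i, pi i <= Lambda.

Lemma is_cvg_avg_rate : cvgn (series (fun i => pi i * P i)).
Proof.
apply: (is_cvg_series_mean _ Lambda) => //; first exact: stat_prob_ge0.
  by move=> i; rewrite pi_ge0 pi_le.
exact: cvg_stat_prob.
Qed.

Lemma avg_rate_ge0 : 0 <= avg_rate C mu pi.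
Proof.
rewrite /avg_rate; have := le_series_lim _ _ 0%N _ is_cvg_avg_rate.
by rewrite /series/= big_geq//; apply => i; rewrite mulr_ge0// stat_prob_ge0.
Qed.

Lemma avg_rate_le_capacity : avg_rate C mu pi <= mu * C%:R.
Proof.
rewrite /avg_rate; apply: limr_le; first exact: is_cvg_avg_rate.
near=> n.
(* Balance shifts the index by one, so n arrival terms are charged to the first n + 1
   probabilities. *)
have P1 : series P n.+1 <= 1.
  rewrite -(cvg_lim (@Rhausdorff R) cvg_stat_prob).
  by apply: le_series_lim; [exact: stat_prob_ge0|apply/cvg_ex; exists 1; exact: cvg_stat_prob].
have muC : 0 <= mu * C%:R by rewrite mulr_ge0// ltW.
apply: le_trans (_ : mu * C%:R * series P n.+1 <= _); last by rewrite ler_piMr.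
rewrite /series/= big_nat_recl//= mulrDr -[leLHS]add0r.
apply: lerD; first by rewrite mulr_ge0 ?stat_prob_ge0.
rewrite mulr_sumr; apply: ler_sum => i _.
rewrite stat_prob_balance ler_wpM2r ?stat_prob_ge0// /service_rate.
by rewrite ler_wpM2l ?(ltW mu_gt0)// ler_nat geq_minr.
Unshelve. all: by end_near.
Qed.

Lemma avg_rate_le_occupancy :
  ((avg_rate C mu pi / mu)%:E <= \sum_(0 <= i <oo) (i%:R * P i)%:E)%E.
Proof.
have iP0 i : 0 <= i%:R * P i by rewrite mulr_ge0// stat_prob_ge0.
(* An infinite mean occupancy makes the bound trivial; otherwise the series converges in the
   reals. *)
have [|] := leP +oo%E (\sum_(0 <= i <oo) (i%:R * P i)%:E)%E.
  by apply: le_trans; rewrite leey.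
move=> fin; have co := nnseries_is_cvg iP0 fin.
rewrite eseries_EFin// lee_fin ler_pdivrMr//.
rewrite /avg_rate; apply: limr_le; first exact: is_cvg_avg_rate.
near=> n.
rewrite mulrC -ler_pdivrMl//.
apply: le_trans (le_series_lim _ _ n.+1 iP0 co).
rewrite /series/= big_nat_recl//= mul0r add0r mulr_sumr; apply: ler_sum => i _.
rewrite stat_prob_balance mulrA ler_wpM2r ?stat_prob_ge0//.
by rewrite /service_rate mulKf ?gt_eqF// ler_nat geq_minl.
Unshelve. all: by end_near.
Qed.

End birth_death.

(** * The truncated chain, its blocking probability, and static policies *)

Section cutoff.
Variables (R : realType) (C : nat).
Hypothesis C_gt0 : (0 < C)%N.

Let W (rho : R) := bd_weight (fun=> rho) (service_rate C 1).

(** Isolates the dependence on the load in a power, so that weights at two loads can be compared. *)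
Lemma cutoff_weightE rho i : W rho i = rho ^+ i * W 1 i.
Proof.
elim: i => [|i IH]; first by rewrite /W !bd_weight0 mulr1.
by rewrite /W !bd_weightS -!/(W _) IH exprSr mul1r; ring.
Qed.

Lemma cutoff_weight_ge0 rho i : 0 <= rho -> 0 <= W rho i.
Proof. by move=> r0; apply: bd_weight_ge0 => // k; rewrite ltW// service_rate_gt0. Qed.

Lemma sum_cutoff_weight_gt0 rho n : 0 <= rho -> 0 < \sum_(j < n.+1) W rho j.
Proof.
move=> r0; rewrite big_ord_recl/= /W bd_weight0 ltr_pwDl// sumr_ge0// => j _.
exact: cutoff_weight_ge0.
Qed.

Lemma cutoff_prob_ge0 (rho : R) gamma i : 0 <= rho -> 0 <= cutoff_prob gamma C rho i.
Proof.
move=> r0; rewrite /cutoff_prob -/(W rho) divr_ge0 ?cutoff_weight_ge0//.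
by rewrite ltW// sum_cutoff_weight_gt0.
Qed.

Lemma cutoff_prob_le1 (rho : R) gamma : 0 <= rho ->
  cutoff_prob gamma C rho gamma.+1 <= 1.
Proof.
move=> r0; rewrite ler_pdivrMr ?sum_cutoff_weight_gt0// mul1r big_ord_recr/= lerDr.
by apply: sumr_ge0 => j _; exact: cutoff_weight_ge0.
Qed.

(** Serves the policy that admits nobody and the degenerate case of a zero average rate. *)
Lemma cutoff_prob_rate0 gamma i : cutoff_prob gamma C (0 : R) i.+1 = 0.
Proof. by rewrite /cutoff_prob -/(W 0) cutoff_weightE expr0n !mul0r. Qed.

(* After cross-multiplication the claim holds term by term:
   rho^j r^n >= rho^n r^j for j <= n. *)
Lemma le_blocking (rho r : R) gamma : 0 <= rho -> rho <= r ->
  cutoff_prob gamma C rho gamma.+1 <= cutoff_prob gamma C r gamma.+1.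
Proof.
move=> rho0 rho_r; have r0 := le_trans rho0 rho_r.
rewrite /cutoff_prob -/(W rho) -/(W r).
rewrite ler_pdivrMr ?sum_cutoff_weight_gt0// mulrAC ler_pdivlMr ?sum_cutoff_weight_gt0//.
rewrite !mulr_sumr; apply: ler_sum => -[j /= jn] _.
rewrite !(cutoff_weightE rho) !(cutoff_weightE r).
have -> : gamma.+1 = (j + (gamma.+1 - j))%N by rewrite subnKC.
set m := (_ - j)%N; rewrite !exprD.
(* With n = j + m, both sides share every factor except rho^m on the left and r^m on the right. *)
have mulE (a b x y s : R) : x * a * s * (y * b) = x * y * s * b * a by ring.
rewrite !mulE (mulrC (r ^+ j)) ler_wpM2l//; last exact: lerXn2r.
by rewrite !mulr_ge0 ?exprn_ge0 ?cutoff_weight_ge0.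
Qed.

Lemma cutoff_weight_low i : (i <= C)%N -> W C%:R i = (i`!)%:R^-1 * C%:R ^+ i.
Proof.
rewrite cutoff_weightE => iC; rewrite mulrC; congr (_ * _).
elim: i iC => [_|i IH iC]; first by rewrite /W bd_weight0 fact0 invr1.
rewrite /W bd_weightS -/(W _) IH ?(ltnW iC)// factS natrM /service_rate (minn_idPl iC).
by rewrite !mul1r invfM mulrC.
Qed.

(** At load C, birth and death rates coincide once all servers are busy, so the weights are constant
    from state C on. *)
Lemma cutoff_weight_high d : W C%:R (C + d) = (C`!)%:R^-1 * C%:R ^+ C.
Proof.
elim: d => [|d IH]; first by rewrite addn0 cutoff_weight_low.
rewrite addnS /W bd_weightS -/(W _) IH /service_rate (minn_idPr _) ?mul1r.
  by rewrite divff ?mulr1// pnatr_eq0 -lt0n.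
by rewrite (leq_trans (leq_addr d C)).
Qed.

Lemma sum_cutoff_weight_capacity d : \sum_(j < (C + d).+1) W C%:R j =
  \sum_(l < C.+1) (l`!)%:R^-1 * C%:R ^+ l + (C`!)%:R^-1 * C%:R ^+ C * d%:R.
Proof.
elim: d => [|d IH].
  rewrite addn0 mulr0 addr0; apply: eq_bigr => -[j /= jC] _.
  by rewrite cutoff_weight_low.
by rewrite addnS big_ord_recr/= IH -addnS cutoff_weight_high -natr1; ring.
Qed.

(** The hypothesis puts the blocking state gamma + 1 at or above C, in the range where the weights
    are constant. *)
Lemma blocking_capacity gamma : (C.-1 <= gamma)%N ->
  cutoff_prob gamma C (C%:R : R) gamma.+1 = (C%:R ^+ C / (C`!)%:R) /
       (\sum_(l < C.+1) (l`!)%:R^-1 * C%:R ^+ l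
        + (C`!)%:R^-1 * C%:R ^+ C * (gamma.+1%:R - C%:R)).
Proof.
move=> Cg; have Cg1 : (C <= gamma.+1)%N by rewrite -(prednK C_gt0).
rewrite /cutoff_prob -/(W _) -natrB// -(subnKC Cg1) addKn.
by rewrite sum_cutoff_weight_capacity cutoff_weight_high (mulrC (C%:R ^+ C)).
Qed.

Variables (mu l : R) (gamma : nat).
Hypotheses (mu_gt0 : 0 < mu) (l_ge0 : 0 <= l).

Let ps := static_policy l gamma.

Lemma static_policy_ge0 i : 0 <= ps i.
Proof. by rewrite /ps /static_policy; case: ifP. Qed.

(** The weight of state i involves births in states below i only, all at rate l here, and rescaling
    time by mu leaves only the load l / mu. *)
Lemma static_weightE i : (i <= gamma.+1)%N ->
  bd_weight ps (service_rate C mu) i = W (l / mu) i.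
Proof.
elim: i => [|i IH] ig; first by rewrite /W !bd_weight0.
rewrite /W !bd_weightS IH ?(ltnW ig)// /ps /static_policy -ltnS ig.
by congr (_ * _); rewrite /service_rate mul1r invfM mulrA.
Qed.

Lemma static_weight0 i : (gamma.+2 <= i)%N -> bd_weight ps (service_rate C mu) i = 0.
Proof.
move=> gi; apply/eqP; rewrite prodf_seq_eq0; apply/hasP.
(* The vanishing factor is the birth rate in state gamma + 1, the first state that admits nobody. *)
exists (Ordinal (leq_trans (ltnSn _) gi)); first by rewrite mem_index_enum.
by rewrite /= /ps /static_policy ltnn mul0r.
Qed.

Let cvg_static_weight := cvg_series_finite _ _ _ static_weight0.

Lemma static_stable : stable C mu ps.
Proof.
rewrite /stable /normalizer eseries_EFin ?ltry//.
by apply/cvg_ex; eexists; exact: cvg_static_weight.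
Qed.

Lemma static_stat_probE i : (i <= gamma.+1)%N ->
  stat_prob C mu ps i = cutoff_prob gamma C (l / mu) i.
Proof.
move=> ig; rewrite stat_probE//; [|exact: static_policy_ge0|exact: static_stable].
rewrite (cvg_lim _ cvg_static_weight)//= static_weightE// big_mkord.
congr (_ / _); apply: eq_bigr => -[j /= jg] _; exact: static_weightE.
Qed.

Lemma static_stat_prob0 i : (gamma.+2 <= i)%N -> stat_prob C mu ps i = 0.
Proof. by move=> gi; rewrite /stat_prob static_weight0// mul0r. Qed.

Lemma sum_cutoff_prob (rho : R) : 0 <= rho -> \sum_(i < gamma.+2) cutoff_prob gamma C rho i = 1.
Proof. by move=> r0; rewrite -mulr_suml divff// gt_eqF// sum_cutoff_weight_gt0. Qed.

(** Revenue accrues at rate l p(l) in every state of the truncated chain except the blocking state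
    gamma + 1. *)
Lemma static_revenue price : revenue C mu price ps =
  l * price l * (1 - cutoff_prob gamma C (l / mu) gamma.+1).
Proof.
rewrite /revenue (cvg_lim _ (cvg_series_finite _ _ gamma.+1 _))//; last first.
  by move=> i gi; rewrite /ps /static_policy leqNgt gi !mul0r.
rewrite -(sum_cutoff_prob (l / mu)) ?divr_ge0 ?(ltW mu_gt0)// big_ord_recr/= addrK.
rewrite big_mkord mulr_sumr; apply: eq_bigr => -[i /= ig] _.
by rewrite static_stat_probE ?(ltnW ig)// /ps /static_policy -ltnS ig.
Qed.

Lemma static_cost c : cost C mu c ps =
  (c * \sum_(1 <= i < gamma.+2) i%:R * cutoff_prob gamma C (l / mu) i)%:E.
Proof.
have h : series (fun i => i%:R * stat_prob C mu ps i) @ \oo -->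
    \sum_(0 <= i < gamma.+2) i%:R * stat_prob C mu ps i.
  by apply: cvg_series_finite => i gi; rewrite static_stat_prob0// mulr0.
rewrite /cost asboolT; last exact: static_stable.
rewrite eseries_EFin; last by apply/cvg_ex; eexists; exact: h.
rewrite (cvg_lim _ h)// -EFinM big_ltn// mul0r add0r; congr (_ * _)%:E.
by apply: eq_big_nat => i /andP[_ ig]; rewrite static_stat_probE.
Qed.

End cutoff.

(** * Comparison of the static policy with the optimal one *)

Theorem theorem4 (R : realType) (C : nat) (Lambda mu c : R)
    (F : probability (measurableTypeR R) R)
    (prices : set R) (price : R -> R)
    (C_gt0 : (1 <= C)%N) (Lambda_gt0 : 0 < Lambda) (mu_gt0 : 0 < mu)
    (c_gt0 : 0 < c)
    (F_regular : myerson_regular F)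
    (price_inv : inverse_demand Lambda F prices price)
    (rev_concave : concave_revenue Lambda price)
    (pi : nat -> R) (pi_opt : optimal_policy C Lambda mu c price pi)
    (gamma : nat) (gamma_ge : (C.-1 <= gamma)%N) :
  let pi_static := static_policy (avg_rate C mu pi) gamma in
  (1 - (C%:R ^+ C / (C`!)%:R) /
       (\sum_(l < C.+1) (l`!)%:R^-1 * C%:R ^+ l
        + (C`!)%:R^-1 * C%:R ^+ C * (gamma.+1%:R - C%:R)))
    * revenue C mu price pi <= revenue C mu price pi_static
  /\ (cost C mu c pi_static <= g gamma C * cost C mu c pi)%E.
Proof.
move=> pi_static.
case: pi_opt => pi_policy pi_max.
have pi_ge0 i : 0 <= pi i by case/andP: (pi_policy i).
have pi_le i : pi i <= Lambda by case/andP: (pi_policy i).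
have objective_ge0 : (0 <= objective C mu c price pi)%E.
  (* Writing the null policy as a static one makes the formulas for static revenue and cost
     available; [price 0] is multiplied by 0. *)
  have zeroE : static_policy (0 : R) 0 = fun=> 0.
    by apply/funext => i; rewrite /static_policy if_same.
  apply: le_trans (pi_max (static_policy 0 0) _); last first.
    by move=> i; rewrite zeroE lexx ltW.
  rewrite /objective static_revenue// static_cost// !mul0r.
  by rewrite big_nat1 cutoff_prob_rate0// mulr0 mulr0 oppe0 adde0.
have pi_stable : stable C mu pi.
  (* Instability would make the cost infinite and the objective minus infinity. *)
  apply: contrapT => unst; move: objective_ge0.
  by rewrite /objective /cost asboolF.
have P_ge0 := stat_prob_ge0 _ _ _ _ C_gt0 mu_gt0 pi_ge0 pi_stable.
have P_cvg := cvg_stat_prob _ _ _ _ C_gt0 mu_gt0 pi_ge0 pi_stable.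
set lt := avg_rate C mu pi in pi_static *.
have lt_ge0 : 0 <= lt := avg_rate_ge0 _ _ _ Lambda _ C_gt0 mu_gt0 pi_ge0 pi_stable pi_le.
have lt_C : lt / mu <= C%:R.
  rewrite ler_pdivrMr// mulrC.
  exact: avg_rate_le_capacity _ _ _ Lambda _ C_gt0 mu_gt0 pi_ge0 pi_stable pi_le.
have costE : cost C mu c pi = (c%:E * \sum_(0 <= i <oo) (i%:R * stat_prob C mu pi i)%:E)%E.
  by rewrite /cost asboolT.
have cost_ge : ((c * (lt / mu))%:E <= cost C mu c pi)%E.
  rewrite costE EFinM lee_pmul2l// ?lte_fin//.
  exact: avg_rate_le_occupancy _ _ _ Lambda _ C_gt0 mu_gt0 pi_ge0 pi_stable pi_le.
have rho_ge0 : 0 <= lt / mu by rewrite divr_ge0// ltW.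
have cost_ge0 : (0 <= cost C mu c pi)%E.
  by apply: le_trans cost_ge; rewrite lee_fin mulr_ge0// ltW.
split.
(* The sign is needed to multiply the comparison of blocking probabilities by the revenue. *)
- have revenue_ge0 : 0 <= revenue C mu price pi.
    rewrite -lee_fin; apply: le_trans objective_ge0 _.
    by rewrite -[leRHS]adde0 leeD2l// oppe_le0.
  have jensen : revenue C mu price pi <= lt * price lt.
    apply: (concave_jensen _ Lambda (fun l => l * price l) Lambda_gt0 _ (mul0r _)
      _ _ P_ge0 pi_policy P_cvg) => t x y t01 xL yL.
    have := rev_concave (Itv01 (andP t01).1 (andP t01).2) x y.
    rewrite !inE/= !convRE/= => /(_ xL yL).
    rewrite -[X in - (X * price X)]/(t * x + (1 - t) * y) /unstable.onem; lra.
  rewrite static_revenue// -blocking_capacity//.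
  have block_le := le_blocking R C C_gt0 _ _ gamma rho_ge0 lt_C.
  apply: le_trans (_ : (1 - cutoff_prob gamma C (lt / mu) gamma.+1) * revenue C mu price pi <= _).
    by rewrite ler_wpM2r// lerD2l lerN2.
  by rewrite mulrC ler_wpM2r// subr_ge0 cutoff_prob_le1.
- rewrite static_cost//.
  have le_g r : 0 < r <= C%:R ->
      (((\sum_(1 <= i < gamma.+2) i%:R * cutoff_prob gamma C r i) / r)%:E <= g gamma C :> \bar R)%E.
    by move=> rC; apply: ereal_sup_ubound; exists r.
  have ratio_ge0 r : 0 < r -> 0 <= (\sum_(1 <= i < gamma.+2) i%:R * cutoff_prob gamma C r i) / r :> R.
    move=> r0; rewrite divr_ge0 ?(ltW r0)// sumr_ge0// => i _.
    by rewrite mulr_ge0// cutoff_prob_ge0// ltW.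
  (* Load 0 lies outside the range of the supremum. There the static cost is 0, and [g] is
     nonnegative because of its value at load 1, which is admissible since C is at least 1. *)
  have [->|lt_neq0] := eqVneq lt 0.
    rewrite mul0r big_nat big1 ?mulr0 => [|[|i]//]; last by rewrite cutoff_prob_rate0 mulr0.
    have C1 : 0 < (1 : R) <= C%:R by rewrite ltr01 ler1n.
    rewrite mule_ge0//; apply: le_trans (le_g _ C1).
    by rewrite lee_fin ratio_ge0.
  have lt_gt0 : 0 < lt by rewrite lt_def lt_neq0.
  have rho_gt0 : 0 < lt / mu by rewrite divr_gt0.
  have rhoC : 0 < lt / mu <= C%:R by rewrite rho_gt0.
  have crho_ge0 : (0 <= (c * (lt / mu))%:E)%E by rewrite lee_fin mulr_ge0// ltW.
  have ratio0 := ratio_ge0 _ rho_gt0; rewrite -lee_fin in ratio0.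
  (* The static cost is the ratio at load lt / mu times c * (lt / mu); the first factor is at most
     [g], the second at most the cost of [pi]. *)
  have := lee_pmul ratio0 crho_ge0 (le_g _ rhoC) cost_ge.
  by rewrite -EFinM mulrCA divfK ?gt_eqF.
Qed.
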